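(* For every integer $n\ge 1$ there is a bijection $\beta:\mathcal{SM}(n)\to\mathcal{B}(n)$ such that, for all integers $k,p\ge 0$, $\beta$ restricts to a bijection between $\mathcal{SM}(n,k,p)$ and $\mathcal{B}(n,k,p)$.
   Context: All matrices are square (of dimension at least $1$) with nonnegative integer entries; the dimension of a matrix is its number of rows, and rows and columns are numbered starting from $1$ (top to bottom, left to right). The size of a matrix is the sum of all its entries; the sum of a row (column) is the sum of the entries in it. In a matrix of dimension $m$, a cell $(i,j)$ is an SE-cell if $i+j>m+1$. A super triangular matrix is an upper-triangular matrix all of whose SE-cells are zero. For $r\ge 0$, $\mathcal{SM}_r(n)$ is the set of super triangular matrices of size $n$ and dimension $2r+1$ such that: (a) for each $1\le i\le r$, column $i$ contains a nonzero entry; (b) for each $1\le i\le r$, row $r+1-i$ or column $r+1+i$ (or both) contains a nonzero entry. Put $\mathcal{SM}(n)=\bigcup_{r\ge 0}\mathcal{SM}_r(n)$. The center column of a matrix of dimension $2r+1$ is column $r+1$. $\mathcal{SM}(n,k,p)$ is the set of matrices in $\mathcal{SM}(n)$ whose first row has sum $k$ and whose center column has sum $p$. $\mathcal{B}(n)$ is the set of upper-triangular matrices of nonnegative integers of size $n$ in which every row other than the first contains a nonzero entry (the first row may be zero or nonzero). $\mathcal{B}(n,k,p)$ is the set of matrices in $\mathcal{B}(n)$ whose first row has sum $p$ and whose last column has sum $k$. *)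

(* Defs.v *)
From mathcomp Require Import all_boot all_algebra.
From mathcomp Require Import boolp classical_sets functions.

Set Implicit Arguments.
Unset Strict Implicit.
Unset Printing Implicit Defensive.

Local Open Scope classical_set_scope.
Local Open Scope nat_scope.

(* The dimension is the successor of the tag, hence at least 1. *)
Definition sqmx := {m : nat & 'M[nat]_m.+1}.

Definition dim (A : sqmx) : nat := (tag A).+1.

Definition entry (A : sqmx) (x y : 'I_(dim A)) : nat := tagged A x y.

Definition mxsize (A : sqmx) : nat :=
  \sum_(x < dim A) \sum_(y < dim A) entry x y.

(* Ordinals count from 0, whereas row and column numbers [i], [j] count from 1:
   the ordinal [x] stands for the row or column number [x.+1]. *)
Definition row_sum (A : sqmx) (i : nat) : nat :=
  \sum_(x < dim A | x.+1 == i) \sum_(y < dim A) entry x y.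

Definition col_sum (A : sqmx) (j : nat) : nat :=
  \sum_(y < dim A | y.+1 == j) \sum_(x < dim A) entry x y.

Definition nonzero_row (A : sqmx) (i : nat) : Prop :=
  exists x y : 'I_(dim A), x.+1 = i /\ entry x y != 0.

Definition nonzero_col (A : sqmx) (j : nat) : Prop :=
  exists x y : 'I_(dim A), y.+1 = j /\ entry x y != 0.

Definition upper_triangular (A : sqmx) : Prop :=
  forall x y : 'I_(dim A), y < x -> entry x y = 0.

Definition SE_cell (A : sqmx) (x y : 'I_(dim A)) : bool :=
  dim A + 1 < x.+1 + y.+1.

Definition super_triangular (A : sqmx) : Prop :=
  upper_triangular A /\
  forall x y : 'I_(dim A), SE_cell x y -> entry x y = 0.

Definition SMr (r n : nat) : set sqmx :=
  [set A | [/\ super_triangular A,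
               mxsize A = n,
               dim A = 2 * r + 1,
               forall i, 1 <= i <= r -> nonzero_col A i &
               forall i, 1 <= i <= r ->
                 nonzero_row A (r + 1 - i) \/ nonzero_col A (r + 1 + i)]].

Definition SM (n : nat) : set sqmx := \bigcup_r SMr r n.

(* The center column of a matrix of dimension [2 * r + 1] is column [r + 1]. *)
Definition center (A : sqmx) : nat := (dim A)./2 + 1.

Definition SMkp (n k p : nat) : set sqmx :=
  [set A | [/\ SM n A, row_sum A 1 = k & col_sum A (center A) = p]].

Definition B (n : nat) : set sqmx :=
  [set A | [/\ upper_triangular A,
               mxsize A = n &
               forall i, 2 <= i <= dim A -> nonzero_row A i]].

Definition Bkp (n k p : nat) : set sqmx :=
  [set A | [/\ B n A, row_sum A 1 = p & col_sum A (dim A) = k]].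

(* Main.v *)
(* Both families are counted by generating functions with X marking the size and
   U, V marking the two statistics. Group the cells of a matrix of dimension
   2r+1 into r columns C_j (the columns left of the center) and r hooks H_j (row
   j together with its mirror column 2r-j, counting from 0). Conditions (a) and
   (b) say that no C_j and no H_j is empty, and every cell of the first row lies
   in H_0. Inclusion-exclusion over the set of hooks forced to be empty leaves a
   sum over r-step paths in which, once k hooks are left free, a step contributes
   either (y_k - 1) y_k (new free hook) or -(y_k - 1) (new empty hook), where y_k
   is the generating function of a column of k cells. Summing over all r, the
   runs of empty hooks form geometric series of ratio -(y_k - 1), with sum 1/y_k;
   this cancels the factor y_k and leaves sum_m b a^m prod_(1<=i<=m) (y_i - 1),
   which is the generating function of B, read row by row. Everything is done
   with polynomials, cutting the entries at n and working modulo X^(n+1). *)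
Require Import Defs.
From mathcomp Require Import all_boot all_algebra.
From mathcomp Require Import boolp.
From mathcomp Require Import ring zify.

Set Implicit Arguments.
Unset Strict Implicit.
Unset Printing Implicit Defensive.

Import GRing.Theory Num.Theory.
Local Open Scope ring_scope.

(** * Divisibility by powers of the variable, and the hook recursion *)

(** Plays the role of congruence to zero modulo ['X^n]; the explicit cofactor makes sense over any
    commutative ring. *)
Definition divX (K : comNzRingType) (n : nat) (p : {poly K}) := exists q, p = q * 'X^n.

Section DivX.
Variable K : comNzRingType.
Implicit Types p q z : {poly K}.

Lemma divXD n p q : divX n p -> divX n q -> divX n (p + q).
Proof. by move=> [p' ->] [q' ->]; exists (p' + q'); rewrite mulrDl. Qed.

Lemma divX0 n : divX n (0 : {poly K}).
Proof. by exists 0; rewrite mul0r. Qed.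

Lemma divXMl n p q : divX n q -> divX n (p * q).
Proof. by move=> [q' ->]; exists (p * q'); rewrite mulrA. Qed.

Lemma divXM m n p q : divX m p -> divX n q -> divX (m + n) (p * q).
Proof. by move=> [p' ->] [q' ->]; exists (p' * q'); rewrite exprD; ring. Qed.

Lemma divX_sum n (I : Type) (s : seq I) (P : pred I) (F : I -> {poly K}) :
  (forall i, P i -> divX n (F i)) -> divX n (\sum_(i <- s | P i) F i).
Proof. by move=> h; apply: (big_ind (@divX K n)) => //; [exact: divX0|exact: divXD]. Qed.

Lemma divX_coef n p i : divX n p -> (i < n)%N -> p`_i = 0.
Proof. by move=> [q ->] lin; rewrite coefMXn lin. Qed.

(** Replaces the inversion of a series with constant term 1: the identity [p = z * p - (z - 1) * p]
    raises the known divisibility of [p] by one power of ['X] at a time, up to [n]. *)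
Lemma divX_cancel n p z : divX 1 (z - 1) -> divX n (z * p) -> divX n p.
Proof.
move=> z1 zp.
suff h j : (j <= n)%N -> divX j p by exact: h.
elim: j => [_|j IHj ltjn]; first by exists p; rewrite expr0 mulr1.
have -> : p = z * p + (-1) * ((z - 1) * p) by ring.
apply: divXD; last by apply: divXMl; rewrite -add1n; apply: divXM => //; apply/IHj/ltnW.
case: zp => q ->; exists (q * 'X^(n - j.+1)).
by rewrite -mulrA -exprD subnK.
Qed.

End DivX.

(* [hookcoef y r k] is the signed weight of the [r]-step paths that end with [k]
   free hooks. *)
Fixpoint hookcoef (R : pzRingType) (y : nat -> R) (r k : nat) : R :=
  if r is r'.+1 then
    (y k - 1) * ((if k is k'.+1 then y k * hookcoef y r' k' else 0) - hookcoef y r' k)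
  else (k == 0)%:R.

Lemma hookcoef_gt (R : pzRingType) (y : nat -> R) r k : (r < k)%N -> hookcoef y r k = 0.
Proof.
elim: r k => [|r IHr] [|k] //= ltrk.
by rewrite !IHr ?(ltnW ltrk)// mulr0 subrr mulr0.
Qed.

Section HookCoef.
Variables (K : comNzRingType) (y : nat -> {poly K}).
Hypotheses (y0 : y 0 = 1) (yX : forall k, divX 1 (y k - 1)).
Local Notation d := (hookcoef y).

Lemma hookcoefS0 r : d r.+1 0 = 0.
Proof. by rewrite /= y0 subrr mul0r. Qed.

(** Every step contributes a factor [y k - 1], divisible by ['X]; hence paths with more than [n]
    steps vanish modulo ['X^n.+1]. *)
Lemma divX_hookcoef r k : divX r (d r k).
Proof.
elim: r k => [|r IHr] k; first by exists (d 0 k); rewrite expr0 mulr1.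
rewrite /= -add1n; apply: divXM; first exact: yX.
apply: divXD; last by rewrite -mulN1r; apply/divXMl/IHr.
by case: k => [|k]; [exact: divX0|apply/divXMl/IHr].
Qed.

(* Summing the recursion over [r] gives [y_k D_k = (y_k - 1) y_k D_(k-1)] up to the
   boundary term [hookcoef y n.+1 k], which is divisible by ['X^n.+1]. *)
Lemma sum_hookcoef n k :
  divX n.+1 (\sum_(r < n.+1) d r k - \prod_(i < k) (y i.+1 - 1)).
Proof.
elim: k => [|k IHk].
  rewrite big_ord0 big_ord_recl [d 0 0]/= big1 => [|i _]; last exact: hookcoefS0.
  by rewrite addr0 subrr; exact: divX0.
rewrite [X in _ - X]big_ord_recr /=; set Q := \prod_(_ < k) _ in IHk *.
apply: (divX_cancel (yX k.+1)).
set D := \sum_(r < n.+1) d r k.+1; set D' := \sum_(r < n.+1) d r k in IHk.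
have rec : D = (y k.+1 - 1) * (y k.+1 * D' - D) - d n.+1 k.+1.
  have e : D + d n.+1 k.+1 = (y k.+1 - 1) * (y k.+1 * D' - D).
    rewrite /D -(big_ord_recr n.+1 (fun r => d r k.+1)) big_ord_recl /= add0r.
    by rewrite -mulr_sumr sumrB mulr_sumr.
  by rewrite -e addrK.
have -> : y k.+1 * (D - Q * (y k.+1 - 1)) =
    (y k.+1 * (y k.+1 - 1)) * (D' - Q) + (-1) * d n.+1 k.+1.
  have -> : y k.+1 * (D - Q * (y k.+1 - 1)) = D + (y k.+1 - 1) * D - y k.+1 * (y k.+1 - 1) * Q by ring.
  rewrite {1}rec; ring.
by apply: divXD; apply: divXMl => //; exact: divX_hookcoef.
Qed.

(** Up to the common factor [b], the first sum is the generating function of the super triangular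
    side and the second that of the upper-triangular side. Exchanging the sums reduces the claim to
    one [k] at a time. *)
Lemma sum_hookcoef_expr n a :
  divX n.+1 (\sum_(r < n.+1) \sum_(k < r.+1) d r k * a ^+ k
             - \sum_(m < n.+1) a ^+ m * \prod_(i < m) (y i.+1 - 1)).
Proof.
have -> : \sum_(r < n.+1) \sum_(k < r.+1) d r k * a ^+ k
    = \sum_(k < n.+1) (\sum_(r < n.+1) d r k) * a ^+ k.
  under [RHS]eq_bigr do rewrite mulr_suml.
  rewrite exchange_big; apply: eq_bigr => r _ /=.
  rewrite (big_ord_widen _ (fun k => d r k * a ^+ k) (ltn_ord r)) big_mkcond /=.
  by apply: eq_bigr => k _; case: ltnP => // ltrk; rewrite hookcoef_gt ?mul0r.
rewrite -sumrB; apply: divX_sum => k _.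
rewrite [X in X - _]mulrC -mulrBr; exact/divXMl/sum_hookcoef.
Qed.
End HookCoef.

(** * Inclusion-exclusion for fillings *)

(** A truncated geometric series: the generating function of one cell of weight [z] with entry at
    most [N]. *)
Definition gsum (R : pzSemiRingType) (N : nat) (z : R) : R := \sum_(e < N.+1) z ^+ e.

Lemma prod_one_sub (R : comPzRingType) (J : finType) (F : J -> R) :
  \prod_j (1 - F j) = \sum_(E : {set J}) (-1) ^+ #|E| * \prod_(j in E) F j.
Proof.
under eq_bigr do rewrite addrC.
rewrite bigA_distr; apply: eq_bigr => E _.
rewrite (bigID (mem E)) /= [X in _ * X]big1 ?mulr1 => [|j /negPf -> //].
rewrite -[RHS]/(_ * _) -prodr_const -big_split /=; apply: eq_bigr => j ->.
by rewrite mulN1r.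
Qed.

(** Here [E] collects the factors that contribute -1. Read from right to left, this folds an
    alternating sum over sets of emptied lines back into a product. *)
Lemma prod_sub_one (R : comPzRingType) (J : finType) (F : J -> R) :
  \prod_j (F j - 1)
  = \sum_(E : {set J}) (-1) ^+ #|E| * \prod_j if j \in E then 1 else F j.
Proof.
under eq_bigr do rewrite addrC.
rewrite bigA_distr; apply: eq_bigr => E _.
rewrite -prodr_const [X in X * _]big_mkcond -big_split /=; apply: eq_bigr => j _.
by case: ifP; rewrite ?mulr1 ?mul1r.
Qed.

Lemma prod_natr_forall (R : comPzRingType) (J : finType) (P Q : pred J) :
  \prod_(j | P j) (Q j)%:R = [forall (j | P j), Q j]%:R :> R.
Proof.
case: forallP => [h|/forallP/forallPn[j]].
  by rewrite big1 // => j Pj; move: (h j); rewrite Pj => /= ->.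
by rewrite negb_imply => /andP[Pj /negPf Qj]; rewrite (bigD1 j) //= Qj mul0r.
Qed.

Section InclusionExclusion.
Variables (R : comNzRingType) (N : nat) (I J1 J2 : finType).
Variables (D : pred I) (inc1 : J1 -> pred I) (inc2 : J2 -> pred I) (wt : I -> R).

(** The support lies in [D] and meets every line of two families. They are kept apart because, for
    super triangular matrices, the sum over sets of columns will collapse into a product while the
    sum over sets of hooks will not. *)
Definition filling (f : {ffun I -> 'I_N.+1}) : bool :=
  [&& [forall i, D i || (f i == ord0)],
      [forall j, [exists (i | inc1 j i), f i != ord0]] &
      [forall j, [exists (i | inc2 j i), f i != ord0]]].

Definition avoids (J : finType) (inc : J -> pred I) (E : {set J}) (i : I) : bool :=
  [forall (j | j \in E), ~~ inc j i].

(** Meeting a line is 1 minus vanishing on it. After expansion, vanishing on all lines of [E] is a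
    condition on each cell separately. *)
Lemma natr_hits (J : finType) (inc : J -> pred I) (f : {ffun I -> 'I_N.+1}) :
  [forall j, [exists (i | inc j i), f i != ord0]]%:R
  = \sum_(E : {set J}) (-1) ^+ #|E| * \prod_i (avoids inc E i || (f i == ord0))%:R :> R.
Proof.
have hit j : [exists (i | inc j i), f i != ord0]%:R
    = 1 - [forall (i | inc j i), f i == ord0]%:R :> R.
  have -> : [exists (i | inc j i), f i != ord0] = ~~ [forall (i | inc j i), f i == ord0].
    by apply/idP/idP => [/exists_inP[i hi fi]|/forall_inPn[i hi fi]]; [apply/forall_inPn|apply/exists_inP]; exists i.
  by move: [forall (i | _), _] => [] /=; rewrite ?subrr ?subr0.
rewrite -(prod_natr_forall R predT (fun j => [exists (i | inc j i), f i != ord0])).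
under eq_bigr do rewrite hit.
rewrite prod_one_sub; apply: eq_bigr => E _; congr (_ * _).
rewrite !prod_natr_forall; congr (nat_of_bool _)%:R.
apply/forall_inP/forallP => [h i /= | h j jE].
  case: (boolP (avoids inc E i)) => //= /forall_inPn[j jE /negPn incji].
  exact: (forall_inP (h j jE)).
apply/forall_inP => i incji; case/orP: (h i) => // /forall_inP /(_ j jE).
by rewrite incji.
Qed.

Lemma sum_filling :
  \sum_(f | filling f) \prod_i wt i ^+ f i
  = \sum_(E1 : {set J1}) \sum_(E2 : {set J2})
      (-1) ^+ #|E1| * (-1) ^+ #|E2|
      * \prod_(i | [&& D i, avoids inc1 E1 i & avoids inc2 E2 i]) gsum N (wt i).
Proof.
rewrite big_mkcond /=.
have ind f : (if filling f then \prod_i wt i ^+ f i else 0)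
    = (filling f)%:R * \prod_i wt i ^+ f i.
  by case: filling; rewrite ?mul1r ?mul0r.
under eq_bigr => f _.
  rewrite ind /filling -mulnb -mulnb !natrM !natr_hits -(prod_natr_forall R predT).
  rewrite big_distrlr mulr_sumr mulr_suml /=.
  over.
rewrite /= exchange_big; apply: eq_bigr => E1 _.
under eq_bigr do rewrite mulr_sumr mulr_suml.
rewrite exchange_big; apply: eq_bigr => E2 _ /=.
(* For fixed [E1] and [E2] all conditions are cellwise, so the sum over fillings is a product over
   cells of the sums of [F i]. *)
pose F i (e : 'I_N.+1) := (D i || (e == ord0))%:R * (avoids inc1 E1 i || (e == ord0))%:R
    * (avoids inc2 E2 i || (e == ord0))%:R * wt i ^+ e.
transitivity ((-1) ^+ #|E1| * (-1) ^+ #|E2|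
    * \sum_(f : {ffun I -> 'I_N.+1}) \prod_i F i (f i)).
  rewrite mulr_sumr; apply: eq_bigr => f _.
  by rewrite /F !big_split /=; ring.
rewrite -bigA_distr_bigA; congr (_ * _).
rewrite [RHS]big_mkcond; apply: eq_bigr => i _; rewrite /F /gsum.
(* A cell outside [D], or on a line of [E1] or [E2], admits only the entry 0 and contributes 1. *)
case: (D i); last first.
  rewrite /= (bigD1 ord0) //= big1 => [|e /negPf ->]; last by rewrite !mul0r.
  by rewrite !orbT expr0 !mul1r addr0.
case: (avoids inc1 E1 i); last first.
  rewrite /= (bigD1 ord0) //= big1 => [|e /negPf ->]; last by rewrite mulr0 !mul0r.
  by rewrite !orbT expr0 !mul1r addr0.
case: (avoids inc2 E2 i); last first.
  rewrite /= (bigD1 ord0) //= big1 => [|e /negPf ->]; last by rewrite mulr0 !mul0r.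
  by rewrite expr0 !mul1r addr0.
by apply: eq_bigr => e _; rewrite !mul1r.
Qed.
End InclusionExclusion.

(** * Super triangular matrices *)

(** Reading [E] as a predicate on all naturals, false from [r] on, avoids casts when row and column
    indices leave ['I_r] or when [r] changes. *)
Definition ordmem (r : nat) (E : {set 'I_r}) (x : nat) : bool := [exists (j | j \in E), j == x :> nat].

Lemma ordmemE r (E : {set 'I_r}) (j : 'I_r) : ordmem E j = (j \in E).
Proof.
apply/exists_inP/idP => [[i iE /eqP/val_inj <- //]|jE].
by exists j.
Qed.

Lemma ordmem_ge r (E : {set 'I_r}) x : (r <= x)%N -> ordmem E x = false.
Proof.
by move=> lerx; apply/exists_inP => -[j _ /eqP jx]; move: (ltn_ord j); rewrite jx ltnNge lerx.
Qed.

Lemma prod_mirror (R : comPzRingType) r (F : nat -> R) :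
  \prod_(y < (2 * r).+1) F y = (\prod_(y < r) F y) * F r * \prod_(j < r) F (2 * r - j)%N.
Proof.
rewrite -!(big_mkord predT) (big_cat_nat (n := r)) ?leq0n //=; last by lia.
rewrite -mulrA; congr (_ * _).
rewrite big_ltn; last by lia.
congr (_ * _).
rewrite big_nat_rev -{1}[r.+1]add0n big_addn.
have -> : ((2 * r).+1 - r.+1 = r)%N by lia.
by rewrite big_mkord; apply: eq_bigr => j _; have jr := ltn_ord j; congr F; lia.
Qed.

Definition sm_cell r (i : 'I_(2 * r).+1 * 'I_(2 * r).+1) : bool :=
  (i.1 <= i.2)%N && (i.1 + i.2 <= 2 * r)%N.
(** Condition (b) at [i = r - j], with rows and columns counted from 0. *)
Definition hook r (j : 'I_r) (i : 'I_(2 * r).+1 * 'I_(2 * r).+1) : bool :=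
  (i.1 == j :> nat) || (i.2 == 2 * r - j :> nat)%N.
Definition left_col r (j : 'I_r) (i : 'I_(2 * r).+1 * 'I_(2 * r).+1) : bool :=
  i.2 == j :> nat.

Lemma avoids_left_col r (E : {set 'I_r}) i :
  avoids (@left_col r) E i = ~~ ordmem E i.2.
Proof. by rewrite /ordmem negb_exists_in; apply: eq_forallb_in => j _; rewrite eq_sym. Qed.

Lemma avoids_hook r (E : {set 'I_r}) i :
  avoids (@hook r) E i = ~~ ordmem E i.1 && ~~ ordmem E (2 * r - i.2).
Proof.
case: i => x y; rewrite /avoids /hook /=; have := ltn_ord y; move: (nat_of_ord x) (nat_of_ord y) => {}x {}y yr.
apply/forall_inP/andP => [h | [/exists_inPn h1 /exists_inPn h2] j jE].
  by split; apply/exists_inPn => j /h; have := ltn_ord j; lia.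
by have := h1 j jE; have := h2 j jE; have := ltn_ord j; lia.
Qed.

(** The joint factor of column [j] and its mirror when [k] of the rows up to [j] are free; [e] says
    that hook [j] is forced to be empty. The left column gives [y k - 1]; the mirror column gives
    [y k] if the hook is free, and otherwise 1 with a sign -1. *)
Definition hookstep (R : pzRingType) (y : nat -> R) (e : bool) (k : nat) :=
  if e then 1 - y k else (y k - 1) * y k.
Definition outcount (e : pred nat) (j : nat) : nat := \sum_(x < j) ~~ e x.

Section SuperTriangular.
Variables (R : comNzRingType) (t w : R).
(* The generating function of a column with [k] free cells: the one in the first
   row has its own weight [t]. *)
Definition colprod (k : nat) : R := if k is k'.+1 then t * w ^+ k' else 1.

Lemma prod_avoid (p q : R) (e : pred nat) j : ~~ e 0 ->
  \prod_(x < j.+1 | ~~ e x) (if x == 0 :> nat then p else q) = p * q ^+ (outcount e j.+1).-1.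
Proof.
move=> e0; rewrite big_mkcond big_ord_recl /= e0; congr (_ * _).
rewrite /outcount big_ord_recl e0 /= -prodrXr.
by apply: eq_bigr => x _; case: (e _).
Qed.

(** Columns [j] and [2 * r - j] both consist of the rows up to [j], so outside the emptied columns
    they have the same free cells, namely the rows not in [E1]. *)
Lemma prod_sm_cell r (g : nat -> nat -> R) (E1 E2 : {set 'I_r}) :
  \prod_(i : 'I_(2 * r).+1 * 'I_(2 * r).+1 |
      [&& sm_cell i, avoids (@hook r) E1 i & avoids (@left_col r) E2 i]) g i.1 i.2
  = (\prod_(y < r) if y \in E2 then 1 else \prod_(x < y.+1 | ~~ ordmem E1 x) g x y)
    * (\prod_(x < r.+1 | ~~ ordmem E1 x) g x r)
    * \prod_(j < r) if j \in E1 then 1 else \prod_(x < j.+1 | ~~ ordmem E1 x) g x (2 * r - j)%N.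
Proof.
pose c x y := [&& (x <= y)%N && (x + y <= 2 * r)%N, ~~ ordmem E1 x && ~~ ordmem E1 (2 * r - y) & ~~ ordmem E2 y].
transitivity (\prod_(y < (2 * r).+1) \prod_(x < (2 * r).+1 | c x y) g x y).
  rewrite (exchange_big_dep predT) //= pair_big_dep /=; apply: eq_bigl => -[x y] /=.
  by rewrite avoids_hook avoids_left_col.
rewrite (prod_mirror r (fun y => \prod_(x < (2 * r).+1 | c x y) g x y)).
have widen y z : (y <= r)%N -> (forall x, (x < (2 * r).+1)%N -> c x z = (x < y.+1)%N && ~~ ordmem E1 x) ->
    \prod_(x < (2 * r).+1 | c x z) g x z = \prod_(x < y.+1 | ~~ ordmem E1 x) g x z.
  move=> yr h; rewrite (big_ord_widen_cond (2 * r).+1 (fun x => ~~ ordmem E1 x) (fun x => g x z)); last by lia.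
  by apply: eq_bigl => x; rewrite h // andbC.
congr (_ * _ * _).
- apply: eq_bigr => y _; have yr := ltn_ord y; case: ifPn => yE.
    by rewrite big1 // => x; rewrite /c ordmemE yE !andbF.
  apply: widen => [|x xr]; first by lia.
  rewrite /c ordmemE yE (@ordmem_ge r E1 (2 * r - y)%N); last by lia.
  by rewrite !andbT; congr (_ && _); lia.
- apply: widen => // x xr; rewrite /c (ordmem_ge E2) //.
  rewrite (@ordmem_ge r E1 (2 * r - r)%N); last by lia.
  by rewrite !andbT; congr (_ && _); lia.
apply: eq_bigr => j _; have jr := ltn_ord j.
have ej : (2 * r - (2 * r - j) = j)%N by lia.
case: ifPn => jE.
  by rewrite big1 // => x; rewrite /c ej ordmemE jE !andbF.
apply: widen => [|x xr]; first by lia.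
rewrite /c ej ordmemE jE (ordmem_ge E2); last by lia.
by rewrite !andbT; congr (_ && _); lia.
Qed.
End SuperTriangular.

(** * Summation over sets of hooks, one hook at a time *)

Definition widen_set r (E : {set 'I_r}) : {set 'I_r.+1} := [set widen_ord (leqnSn r) j | j in E].

Lemma ordmem_widen r (E : {set 'I_r}) : ordmem (widen_set E) = ordmem E.
Proof.
apply: funext => x; apply/exists_inP/exists_inP => [[_ /imsetP[j jE ->] /= jx]|[j jE jx]].
  by exists j.
by exists (widen_ord (leqnSn r) j) => //; exact: imset_f.
Qed.

Lemma ordmem_widenU r (E : {set 'I_r}) x :
  ordmem (ord_max |: widen_set E) x = (x == r) || ordmem E x.
Proof.
rewrite -[ordmem E]ordmem_widen; apply/exists_inP/orP => [[j]|[/eqP ->|/exists_inP[j jE jx]]].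
- rewrite in_setU1 => /orP[/eqP -> /= /eqP <-|jE jx]; first by left.
  by right; apply/exists_inP; exists j.
- by exists ord_max; rewrite ?setU11.
- by exists j; rewrite // in_setU1 jE orbT.
Qed.

Lemma sum_set_ordS (R : nmodType) r (F : {set 'I_r.+1} -> R) :
  \sum_E F E = \sum_(E : {set 'I_r}) (F (widen_set E) + F (ord_max |: widen_set E)).
Proof.
pose narrow (E : {set 'I_r.+1}) : {set 'I_r} := [set j | widen_ord (leqnSn r) j \in E].
have winj : injective (widen_ord (leqnSn r)) by move=> i j /(congr1 val) /= /val_inj.
have maxN E : ord_max \notin widen_set E.
  by apply/imsetP => -[j _ /(congr1 val) /= rj]; have := ltn_ord j; rewrite -rj ltnn.
have narrowK E : narrow (widen_set E) = E.
  by apply/setP => j; rewrite inE mem_imset.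
have widenK (E : {set 'I_r.+1}) : ord_max \notin E -> widen_set (narrow E) = E.
  move=> rE; apply/setP => j; apply/imsetP/idP => [[i + ->]|jE]; first by rewrite inE.
  case: (unliftP ord_max j) jE => [i ->|->] jE; last by rewrite jE in rE.
  have e : lift ord_max i = widen_ord (leqnSn r) i by apply: val_inj; rewrite /= /bump leqNgt ltn_ord.
  by exists i; rewrite ?inE -?e.
rewrite big_split (bigID (fun E : {set _} => ord_max \in E)) /= addrC; congr (_ + _).
  rewrite (reindex_onto (@widen_set r) narrow) => [|E]; last exact: widenK.
  by apply: eq_bigl => E; rewrite maxN narrowK eqxx.
rewrite (reindex_onto (fun E => ord_max |: widen_set E) (fun E => narrow (E :\ ord_max))).
  by apply: eq_bigl => E; rewrite setU11 setU1K ?maxN // narrowK eqxx.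
by move=> E rE; rewrite widenK ?setD1K // setD11.
Qed.

(** A set [E] read in increasing order is a path whose state is the number of free hooks so far.
    Keeping [f] arbitrary lets the induction absorb the last hook into a new test function. *)
Lemma sum_hookstep (R : comNzRingType) (y : nat -> R) r (f : nat -> R) :
  \sum_(E : {set 'I_r}) (\prod_(j < r) hookstep y (ordmem E j) (outcount (ordmem E) j.+1))
    * f (outcount (ordmem E) r)
  = \sum_(k < r.+1) hookcoef y r k * f k.
Proof.
elim: r f => [|r IHr] f.
  rewrite (bigD1 set0) //= [X in _ + X]big1 => [|E /eqP[]]; last by apply/setP => -[].
  by rewrite addr0 big_ord_recl !big_ord0 /outcount big_ord0 addr0.
rewrite sum_set_ordS.
(* The last hook is either free, moving the state from [k] to [k.+1], or empty, leaving it at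
   [k]. *)
pose f' k := (y k.+1 - 1) * y k.+1 * f k.+1 + (1 - y k) * f k.
transitivity (\sum_(k < r.+1) hookcoef y r k * f' k).
  rewrite -IHr; apply: eq_bigr => E _; rewrite ordmem_widen !big_ord_recr /=.
  have outU j : (j <= r)%N -> outcount (ordmem (ord_max |: widen_set E)) j = outcount (ordmem E) j.
    move=> jr; apply: eq_bigr => x _; rewrite ordmem_widenU.
    by rewrite (ltn_eqF (leq_trans (ltn_ord x) jr)).
  have -> : outcount (ordmem E) r.+1 = (outcount (ordmem E) r).+1.
    by rewrite /outcount big_ord_recr /= ordmem_ge // addn1.
  have -> : outcount (ordmem (ord_max |: widen_set E)) r.+1 = outcount (ordmem E) r.
    by rewrite -(outU r) // /outcount big_ord_recr /= ordmem_widenU eqxx addn0.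
  rewrite ordmem_ge // ordmem_widenU eqxx /=.
  under [X in _ + X * _ * _]eq_bigr => j _.
    by rewrite outU ?ltn_ord // ordmem_widenU (ltn_eqF (ltn_ord j)) over.
  by rewrite /= /f'; ring.
(* Both sums extend to the range [r.+2]: the shifted one has a zero term at 0, the other a zero term
   at [r.+1]. *)
pose prev k := if k is k'.+1 then y k * hookcoef y r k' else 0.
transitivity (\sum_(k < r.+2) ((y k - 1) * prev k * f k + hookcoef y r k * ((1 - y k) * f k))).
  rewrite big_split /= [X in _ = X + _]big_ord_recl [X in _ = _ + X]big_ord_recr /=.
  rewrite hookcoef_gt // mulr0 !mul0r add0r addr0 -big_split /=.
  by apply: eq_bigr => k _; rewrite /f' /bump /= add1n add0n; ring.
by apply: eq_bigr => -[[|k] kr] _ /=; ring.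
Qed.

(** For a fixed set [E] of emptied hooks, the sum over sets of left columns folds into the product
    of the [Y j - 1]. Pairing each column with its mirror then yields the weights [hookstep]. *)
Lemma sum_sm_filling (R : comNzRingType) N r (t w a b : R)
    (wt : 'I_(2 * r).+1 * 'I_(2 * r).+1 -> R) :
  (forall i, gsum N (wt i) =
     if i.2 == r :> nat then if i.1 == 0 :> nat then b else a
     else if i.1 == 0 :> nat then t else w) ->
  \sum_(f : {ffun _ -> 'I_N.+1} | filling (@sm_cell r) (@hook r) (@left_col r) f)
    \prod_i wt i ^+ f i
  = b * \sum_(k < r.+1) hookcoef (colprod t w) r k * a ^+ k.
Proof.
move=> gwt; rewrite sum_filling mulr_sumr.
under [RHS]eq_bigr do rewrite mulrCA.
rewrite -(sum_hookstep (colprod t w) r (fun k => b * a ^+ k)).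
apply: eq_bigr => E _.
pose e := ordmem E; pose Y j : R := \prod_(x < j.+1 | ~~ e x) if x == 0 :> nat then t else w.
pose g (x y : nat) : R := if y == r then if x == 0 then b else a else if x == 0 then t else w.
have prodE2 (E2 : {set 'I_r}) :
  \prod_(i | [&& sm_cell i, avoids (@hook r) E i & avoids (@left_col r) E2 i]) gsum N (wt i)
  = (\prod_(y < r) if y \in E2 then 1 else Y y)
    * ((\prod_(x < r.+1 | ~~ e x) if x == 0 :> nat then b else a)
    * \prod_(j < r) if j \in E then 1 else Y j).
  transitivity (\prod_(i : 'I_(2 * r).+1 * 'I_(2 * r).+1 |
      [&& sm_cell i, avoids (@hook r) E i & avoids (@left_col r) E2 i]) g i.1 i.2).
    by apply: eq_bigr => i _; exact: gwt.
  rewrite prod_sm_cell -mulrA; congr (_ * (_ * _)).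
  - by apply: eq_bigr => y _; rewrite /g (ltn_eqF (ltn_ord y)).
  - by apply: eq_bigr => x _; rewrite /g eqxx.
  - apply: eq_bigr => j _; rewrite /g gtn_eqF //.
    by have := ltn_ord j; lia.
under eq_bigr do rewrite prodE2 -mulrA [X in _ * X]mulrA.
rewrite -mulr_sumr -mulr_suml.
rewrite -prod_sub_one.
have -> : (-1) ^+ #|E| = \prod_(j < r) (if j \in E then -1 else 1) :> R.
  by rewrite -prodr_const big_mkcond.
(* If the first hook is forced to be empty, so is column 0, and both sides vanish. *)
have [e0|e0] := boolP (e 0).
  have r_gt0 : (0 < r)%N by case: (posnP r) e0 => // r0; rewrite /e ordmem_ge // r0.
  rewrite [\prod_(y < r) (Y y - 1)](bigD1 (Ordinal r_gt0)) //= [X in _ = X * _](bigD1 (Ordinal r_gt0)) //=.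
  have Y0 : Y 0 = 1 by rewrite /Y big_mkcond big_ord_recl /= e0 /= big_ord0 mulr1.
  rewrite Y0 -/e e0 /= subrr !(mul0r, mulr0).
  by rewrite /outcount big_ord_recl big_ord0 e0 /= subrr !mul0r.
have outS j : outcount e j.+1 = (outcount e j.+1).-1.+1.
  by rewrite /outcount big_ord_recl e0.
have YE j : Y j = colprod t w (outcount e j.+1).
  by rewrite outS; exact: prod_avoid.
rewrite prod_avoid // mulrA [LHS]mulrACA -!big_split /=.
(* Row [r] lies on no hook and is always free, which makes up for row 0, split off as the factor
   [b]. *)
have -> : (outcount e r.+1).-1 = outcount e r.
  by rewrite /outcount big_ord_recr /= /e ordmem_ge // addn1.
rewrite mulrAC -big_split /=; congr (_ * _); apply: eq_bigr => j _.
by rewrite YE -ordmemE -/e /hookstep; case: (e j); ring.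
Qed.

(** * Upper-triangular matrices *)

Definition upper_cell m (i : 'I_m.+1 * 'I_m.+1) : bool := (i.1 <= i.2)%N.
Definition lower_row m (j : 'I_m) (i : 'I_m.+1 * 'I_m.+1) : bool := i.1 == j.+1 :> nat.
(** An empty second family, so that [filling] also serves upper-triangular matrices. *)
Definition no_constraint m (j : 'I_0) (i : 'I_m.+1 * 'I_m.+1) : bool := false.

(** The first row gives [b * a ^+ m]. Every other row must be nonzero, and its generating function
    is that of a column of the same length, with the last-column cell of weight [t] in the role of
    the first-row cell. *)
Lemma sum_upper_filling (R : comNzRingType) N m (t w a b : R)
    (wt : 'I_m.+1 * 'I_m.+1 -> R) :
  (forall i, gsum N (wt i) =
     if i.1 == 0 :> nat then if i.2 == m :> nat then b else a
     else if i.2 == m :> nat then t else w) ->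
  \sum_(f : {ffun _ -> 'I_N.+1} | filling (@upper_cell m) (@lower_row m) (@no_constraint m) f)
    \prod_i wt i ^+ f i
  = b * (a ^+ m * \prod_(i < m) (colprod t w i.+1 - 1)).
Proof.
move=> gwt; rewrite sum_filling.
have void_set (E : {set 'I_0}) : E = set0 by apply/setP => -[].
pose Z (j : nat) : R := \prod_(y < m.+1 | (j <= y)%N) if y == m :> nat then t else w.
have prodE (E : {set 'I_m}) (E2 : {set 'I_0}) :
    \prod_(i | [&& upper_cell i, avoids (@lower_row m) E i & avoids (@no_constraint m) E2 i])
      gsum N (wt i)
    = (b * a ^+ m) * \prod_(j < m) if j \in E then 1 else Z j.+1.
  transitivity (\prod_(x < m.+1) \prod_(y < m.+1 | (x <= y)%N && [forall (j | j \in E), x != j.+1 :> nat])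
     (if x == 0 :> nat then if y == m :> nat then b else a else if y == m :> nat then t else w)).
    rewrite pair_big_dep /=; apply: eq_big => [[x y] | i _]; last exact: gwt.
    rewrite /upper_cell /=; congr (_ && _); rewrite andbC (_ : avoids _ E2 _) //.
    by apply/forall_inP => -[].
  rewrite big_ord_recl; congr (_ * _).
    transitivity (\prod_(y < m.+1) if y == m :> nat then b else a).
      by apply: eq_bigl => y /=; apply/forall_inP.
    rewrite big_ord_recr /= eqxx mulrC; congr (_ * _).
    rewrite -[in RHS](card_ord m) -prodr_const; apply: eq_bigr => y _.
    by rewrite (ltn_eqF (ltn_ord y)).
  apply: eq_bigr => j _ /=; rewrite /bump /= add1n; case: ifPn => jE.
    rewrite big1 // => y /andP[_ /forall_inP/(_ j jE)].
    by rewrite eqxx.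
  apply: eq_bigl => y; rewrite (_ : [forall (_ | _), _]) ?andbT //.
  apply/forall_inP => i iE; apply: contra jE; rewrite eqSS => /eqP/val_inj -> //.
under eq_bigr => E _.
  rewrite (bigD1 set0) //= [X in _ + X]big1 => [|E2 /eqP[]]; last exact: void_set.
  rewrite prodE cards0 expr0 mulr1 addr0 mulrCA.
  over.
rewrite -mulr_sumr -prod_sub_one mulrA; congr (_ * _).
(* Counted from the bottom, row [m - j] has [j.+1] cells. *)
rewrite (reindex_inj rev_ord_inj) /=; apply: eq_bigr => j _; congr (_ - 1).
have jm := ltn_ord j; rewrite /Z big_mkcond big_ord_recr /= eqxx.
rewrite (_ : (_ <= m)%N); last by lia.
rewrite mulrC; congr (_ * _).
rewrite -big_mkcond /= (eq_bigr (fun=> w)) => [|y _]; last by rewrite (ltn_eqF (ltn_ord y)).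
rewrite -(big_geq_mkord _ _ xpredT (fun=> w)) prodr_const_nat; congr (_ ^+ _).
by rewrite /=; lia.
Qed.

(** * Extraction of coefficients *)

Lemma coef_XnC (K : comNzRingType) m (c : K) n : ('X^m * c%:P)`_n = if m == n then c else 0.
Proof. by rewrite coefMC coefXn eq_sym; case: eqP; rewrite ?mul1r ?mul0r. Qed.

Section Weights.
Local Notation P3 := {poly {poly {poly int}}}.
(** Size is marked by the outermost variable, so that truncation by size is divisibility by a power
    of ['X]; the two statistics use the inner variables. *)
Definition cellwt (u v : bool) : P3 := 'X * (('X : {poly {poly int}}) ^+ u)%:P * (('X : {poly int}) ^+ v)%:P%:P.

Variables (N : nat) (I : finType) (U V : pred I).

Lemma coef_cellwt (F : pred {ffun I -> 'I_N.+1}) n k p :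
  (\sum_(f | F f) \prod_i cellwt (U i) (V i) ^+ f i)`_n`_k`_p
  = #|[pred f | [&& F f, \sum_i f i == n, \sum_(i | U i) f i == k & \sum_(i | V i) f i == p]%N]|%:R.
Proof.
rewrite -sum1_card natr_sum /= !coef_sum big_mkcond [RHS]big_mkcond /=.
apply: eq_bigr => f _; rewrite inE; case: (F f) => //=.
have -> : \prod_i cellwt (U i) (V i) ^+ f i
    = 'X^(\sum_i f i) * ('X^(\sum_(i | U i) f i))%:P * ('X^(\sum_(i | V i) f i))%:P%:P :> P3.
  have sum_indicator (Q : pred I) : (\sum_(i | Q i) f i = \sum_i Q i * f i)%N.
    by rewrite big_mkcond; apply: eq_bigr => i _; case: (Q i); rewrite ?mul1n ?mul0n.
  rewrite (sum_indicator U) (sum_indicator V) -!prodrXr !rmorph_prod -!big_split; apply: eq_bigr => i _ /=.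
  by rewrite /cellwt !exprMn -!rmorphXn /= -!exprM.
rewrite -mulrA -polyCM coef_XnC; case: eqP => _; last by rewrite !coef0.
rewrite coef_XnC; case: eqP => _; last by rewrite coef0.
by rewrite coefXn eq_sym; case: eqP.
Qed.
End Weights.

Lemma divX1_horner (K : comNzRingType) (p : {poly K}) : p.[0] = 0 -> divX 1 p.
Proof.
by move=> /eqP/factor_theorem[q ->]; exists q; rewrite subr0 expr1.
Qed.

Lemma gsum_cellwt N u v : (gsum N (cellwt u v)).[0] = 1.
Proof.
rewrite /gsum horner_sum big_ord_recl big1 => [|e _]; first by rewrite expr0 hornerC addr0.
by rewrite /cellwt !exprMn /= !hornerE exprS mul0r !mul0r.
Qed.

Notation cell m := ('I_m.+1 * 'I_m.+1)%type.
Definition top_row m (i : cell m) : bool := i.1 == 0 :> nat.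
Definition column m c (i : cell m) : bool := i.2 == c :> nat.

Definition sm_filling N r n k p (f : {ffun cell (2 * r) -> 'I_N.+1}) : bool :=
  [&& filling (@sm_cell r) (@hook r) (@left_col r) f, \sum_i f i == n,
      \sum_(i | top_row i) f i == k & \sum_(i | column r i) f i == p]%N.

Definition upper_filling N m n k p (f : {ffun cell m -> 'I_N.+1}) : bool :=
  [&& filling (@upper_cell m) (@lower_row m) (@no_constraint m) f, \sum_i f i == n,
      \sum_(i | column m i) f i == k & \sum_(i | top_row i) f i == p]%N.

(** With the statistics exchanged as in the two kinds of filling, both sides use the same four cell
    series [t], [w], [a], [b]; the generating functions then agree modulo ['X^N.+1]. *)
Lemma sm_upper_count N n k p : (n <= N)%N ->
  (\sum_(r < N.+1) #|[pred f | @sm_filling N r n k p f]|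
   = \sum_(m < N.+1) #|[pred f | @upper_filling N m n k p f]|)%N.
Proof.
move=> leqnN; apply/eqP; rewrite -(eqr_nat int) !natr_sum; apply/eqP.
under eq_bigr => r _.
  rewrite -(coef_cellwt (@top_row _) (@column _ r)).
  rewrite (@sum_sm_filling _ _ _ (gsum N (cellwt true false)) (gsum N (cellwt false false))
    (gsum N (cellwt false true)) (gsum N (cellwt true true))); last first.
    by move=> i; rewrite /top_row /column; do 2!case: eqP.
  over.
under [RHS]eq_bigr => m _.
  rewrite -(coef_cellwt (@column _ m) (@top_row _)).
  rewrite (@sum_upper_filling _ _ _ (gsum N (cellwt true false)) (gsum N (cellwt false false))
    (gsum N (cellwt false true)) (gsum N (cellwt true true))); last first.
    by move=> i; rewrite /top_row /column; do 2!case: eqP.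
  over.
rewrite -!coef_sum -!mulr_sumr /=; congr (nth _ (polyseq (nth _ (polyseq _) _)) _).
set y := colprod _ _.
have y0 : y 0 = 1 by [].
have yX i : divX 1 (y i - 1).
  apply: divX1_horner; rewrite !hornerE; case: i => [|i]; first by rewrite hornerE subrr.
  by rewrite /y /= !hornerE !gsum_cellwt expr1n mulr1 subrr.
apply/eqP; rewrite -subr_eq0 -coefB -mulrBr; apply/eqP.
apply: (@divX_coef _ N.+1) => //; apply: divXMl.
exact: sum_hookcoef_expr.
Qed.

Local Close Scope ring_scope.
From HB Require Import structures.
From mathcomp Require Import classical_sets functions cardinality.
Local Open Scope nat_scope.
Local Open Scope classical_set_scope.
Local Open Scope card_scope.

(** * From fillings to matrices *)

Section Entries.
Variables (N m : nat).
Implicit Type f : {ffun cell m -> 'I_N.+1}.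

Definition mx_of f : sqmx := Tagged (fun m => 'M[nat]_m.+1) (\matrix_(x, y) (f (x, y) : nat))%R.

Lemma entry_mx_of f (x y : 'I_m.+1) : @entry (mx_of f) x y = f (x, y).
Proof. by rewrite /entry /= mxE. Qed.

Lemma mxsize_mx_of f : mxsize (mx_of f) = \sum_i f i.
Proof.
rewrite (eq_bigr (fun i : cell m => f (i.1, i.2) : nat)) => [|[]//].
rewrite -(pair_bigA _ (fun x y => f (x, y) : nat)).
by apply: eq_bigr => x _; apply: eq_bigr => y _; rewrite entry_mx_of.
Qed.

Lemma row_sum_mx_of f : row_sum (mx_of f) 1 = \sum_(i | top_row i) f i.
Proof.
rewrite [RHS](eq_bigr (fun i : cell m => f (i.1, i.2) : nat)) => [|[]//].
rewrite (eq_bigl (fun i : cell m => (i.1.+1 == 1) && true)); last by move=> i; rewrite andbT.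
rewrite -(pair_big_dep (fun x : 'I_m.+1 => x.+1 == 1) (fun _ _ => true) (fun x y => f (x, y) : nat)).
by apply: eq_bigr => x _; apply: eq_bigr => y _; rewrite entry_mx_of.
Qed.

Lemma col_sum_mx_of f c : col_sum (mx_of f) c.+1 = \sum_(i | column c i) f i.
Proof.
rewrite [RHS](eq_bigr (fun i : cell m => f (i.1, i.2) : nat)) => [|[]//].
rewrite -(pair_big_dep predT (fun x y : 'I_m.+1 => y == c :> nat) (fun x y => f (x, y) : nat)).
rewrite (exchange_big_dep (fun y : 'I_m.+1 => y == c :> nat)) //=.
by apply: eq_bigr => y yc; apply: eq_big => [x|x _]; rewrite ?entry_mx_of //= (eqP yc) eqxx.
Qed.

Lemma entry_le_mxsize (A : sqmx) (x y : 'I_(Defs.dim A)) : entry x y <= mxsize A.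
Proof. by rewrite /mxsize (bigD1 x) //= (bigD1 y) //= -addnA leq_addr. Qed.

Lemma mx_of_surj (A : sqmx) : tag A = m -> mxsize A <= N -> exists f, mx_of f = A.
Proof.
case: A => m' M /= em; subst m' => leN.
(* No entry exceeds the size, hence [N], so [inord] returns it unchanged. *)
exists [ffun i => inord (M i.1 i.2)]; congr Tagged.
apply/matrixP => x y; rewrite mxE ffunE inordK // ltnS.
by apply: leq_trans leN; exact: (@entry_le_mxsize (Tagged _ M)).
Qed.

Lemma mx_of_inj : injective mx_of.
Proof.
move=> f g fg; apply/ffunP => -[x y]; apply: val_inj => /=.
have /(congr1 (fun M : 'M[nat]_m.+1 => M x y)) : (\matrix_(x, y) (f (x, y) : nat) = \matrix_(x, y) (g (x, y) : nat))%R.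
  exact: eq_from_Tagged fg.
by rewrite !mxE.
Qed.
End Entries.

(** Disjoint lines that each hold a nonzero entry need at least one unit each. This bounds the
    dimension by the size and makes the families finite. *)
Lemma card_le_sum_filling N (I J : finType) (inc : J -> pred I) (f : {ffun I -> 'I_N.+1}) :
  (forall i j j', inc j i -> inc j' i -> j = j') ->
  [forall j, [exists (i | inc j i), f i != ord0]] -> #|J| <= \sum_i f i.
Proof.
move=> disj /forallP hits.
apply: (@leq_trans (\sum_j \sum_(i | inc j i) f i)).
  rewrite -sum1_card; apply: leq_sum => j _.
  have /exists_inP[i ji fi] := hits j.
  by rewrite (bigD1 i) //= (leq_trans _ (leq_addr _ _)) // lt0n.
rewrite (exchange_big_dep predT) //=; apply: leq_sum => i _.
rewrite sum_nat_const -[leqRHS]mul1n leq_mul2r; apply/orP; right.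
apply/card_le1P => j ji j'; apply/idP/eqP => [j'i|-> //].
exact: disj j'i ji.
Qed.

Lemma SMkp_mx_of N r n k p (f : {ffun cell (2 * r) -> 'I_N.+1}) :
  SMkp n k p (mx_of f) <-> sm_filling n k p f.
Proof.
have center_r : center (mx_of f) = r.+1 by rewrite /center /Defs.dim /= ; lia.
rewrite /SMkp /= center_r row_sum_mx_of col_sum_mx_of.
split.
  case=> -[r' _ [[ut se] sz dm hc hr]] <- <-.
  have er : r' = r by move: dm; rewrite /Defs.dim /=; lia.
  subst r'; rewrite /sm_filling -sz mxsize_mx_of !eqxx !andbT.
  apply/and3P; split.
  - apply/forallP => -[x y]; rewrite /sm_cell /=.
    case: leqP => [xy|yx] /=; last by rewrite -val_eqE /= -(entry_mx_of f) ut.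
    case: leqP => //= se'; rewrite -val_eqE /= -(entry_mx_of f) se //.
    by rewrite /SE_cell /Defs.dim /=; lia.
  - apply/forallP => j; have jr := ltn_ord j.
    case: (hr (r - j)) => [|[x [y [xj]]]|[x [y [yj]]]]; first by lia.
      rewrite entry_mx_of => fxy; apply/exists_inP; exists (x, y); rewrite ?fxy //.
      by apply/orP; left; apply/eqP/succn_inj; transitivity (r + 1 - (r - j)); [exact: xj|lia].
    rewrite entry_mx_of => fxy; apply/exists_inP; exists (x, y); rewrite ?fxy //.
    by apply/orP; right; apply/eqP/succn_inj; transitivity (r + 1 + (r - j)); [exact: yj|lia].
  apply/forallP => j; have jr := ltn_ord j.
  case: (hc j.+1) => [|x [y [yj]]]; first by lia.
  rewrite entry_mx_of => fxy; apply/exists_inP; exists (x, y); rewrite ?fxy //.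
  by apply/eqP/succn_inj.
case/and4P => /and3P[/forallP hD /forallP hh /forallP hc] /eqP sz /eqP <- /eqP <-.
split => //; exists r => //; split.
- split=> -[x xm] [y ym]; rewrite entry_mx_of /= => xy.
    by move: (hD (Ordinal xm, Ordinal ym)); rewrite /sm_cell /= leqNgt xy /= => /eqP ->.
  move: (hD (Ordinal xm, Ordinal ym)) => /orP[/andP[_ /= h]|/eqP -> //].
  by move: xy h; rewrite /SE_cell /Defs.dim /=; lia.
- by rewrite mxsize_mx_of.
- by rewrite /Defs.dim /=; lia.
- move=> i /andP[i1 ir]; have ir' : i.-1 < r by lia.
  have /exists_inP[[[x xm] [y ym]]] := hc (Ordinal ir').
  rewrite /left_col /= => yi fxy; exists (Ordinal xm), (Ordinal ym).
  by rewrite entry_mx_of /=; split; [lia | exact: fxy].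
move=> i /andP[i1 ir]; have ir' : r - i < r by lia.
have /exists_inP[[[x xm] [y ym]]] := hh (Ordinal ir').
rewrite /hook /= => /orP[xi|yi] fxy; [left|right]; exists (Ordinal xm), (Ordinal ym);
  by rewrite entry_mx_of /=; split; [lia | exact: fxy].
Qed.

Lemma Bkp_mx_of N m n k p (f : {ffun cell m -> 'I_N.+1}) :
  Bkp n k p (mx_of f) <-> upper_filling n k p f.
Proof.
rewrite /Bkp /= row_sum_mx_of col_sum_mx_of.
split.
  case=> -[ut sz hr] <- <-.
  rewrite /upper_filling -sz mxsize_mx_of !eqxx !andbT.
  apply/and3P; split.
  - apply/forallP => -[x y]; rewrite /upper_cell /=.
    by case: leqP => [xy|yx] //=; rewrite -val_eqE /= -(entry_mx_of f) ut.
  - apply/forallP => j; have jm := ltn_ord j.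
    case: (hr j.+2) => [|x [y [xj]]]; first by rewrite /Defs.dim /=; lia.
    rewrite entry_mx_of => fxy; apply/exists_inP; exists (x, y); rewrite ?fxy //.
    by apply/eqP/succn_inj.
  by apply/forallP => -[].
case/and4P => /and3P[/forallP hD /forallP hr _] /eqP sz /eqP <- /eqP <-.
split => //; split.
- move=> x y; rewrite ?entry_mx_of => xy; move: (hD (x, y)); rewrite /upper_cell /=.
  by rewrite leqNgt xy /= => /eqP ->.
- by rewrite mxsize_mx_of.
move=> i /andP[i2 im]; have im' : i.-2 < m by move: im; rewrite /Defs.dim /=; lia.
have /exists_inP[[[x xm] [y ym]]] := hr (Ordinal im').
rewrite /lower_row /= => xi fxy; exists (Ordinal xm), (Ordinal ym).
by rewrite entry_mx_of /=; split; [lia | exact: fxy].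
Qed.

(** * Equinumerosity and the bijection *)

Lemma card_eq_finpred (T : finType) (Q : pred T) : [set z | Q z] #= `I_#|Q|.
Proof.
have -> : [set z | Q z] = @enum_val T Q @` [set: 'I_#|Q|].
  apply/seteqP; split => [z Qz | _ [i _ <-]]; last exact: enum_valP.
  by exists (enum_rank_in (Qz : z \in Q) z) => //; rewrite enum_rankK_in.
apply: card_eq_trans (inj_card_eq _) _; first by move=> i j _ _; exact: enum_val_inj.
by rewrite card_eq_sym; exact: card_II.
Qed.

Lemma card_eq_mx_of N (sh : nat -> nat) (P : forall r, pred {ffun cell (sh r) -> 'I_N.+1})
    (A : set sqmx) :
  injective sh -> (forall r f, A (mx_of f) <-> P r f) ->
  (forall X, A X -> exists r f, r <= N /\ @mx_of N (sh r) f = X) ->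
  A #= `I_(\sum_(r < N.+1) #|P r|).
Proof.
move=> sh_inj AP A_sub.
pose T := {r : 'I_N.+1 & {ffun cell (sh r) -> 'I_N.+1}}.
pose Q (z : T) := P (tag z) (tagged z); pose emb (z : T) := mx_of (tagged z).
have -> : \sum_(r < N.+1) #|P r| = #|Q|.
  rewrite -[RHS]sum1_card.
  transitivity (\sum_(r < N.+1) \sum_(f | P r f) 1).
    by apply: eq_bigr => r _; rewrite -[LHS]sum1_card.
  rewrite (sig_big_dep predT (fun (r : 'I_N.+1) f => P r f) (fun _ _ => 1)).
  exact: eq_bigl.
have -> : A = emb @` [set z | Q z].
  apply/seteqP; split => [X AX | _ [[r f] Pf <-]]; last exact/AP.
  have [r [f [rN fX]]] := A_sub X AX.
  exists (Tagged (fun r : 'I_N.+1 => {ffun cell (sh r) -> 'I_N.+1}) (f : {ffun cell (sh (Ordinal (rN : r < N.+1))) -> _})).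
    by apply/AP; rewrite fX.
  exact: fX.
apply: card_eq_trans (inj_card_eq _) (card_eq_finpred Q).
move=> [r f] [r' f'] _ _ /= e.
have er : r = r' by apply/val_inj/sh_inj; exact: (congr1 (@tag _ _) e).
by subst r'; congr Tagged; exact: mx_of_inj e.
Qed.

Lemma SMkp_eq_Bkp n k p : SMkp n k p #= Bkp n k p.
Proof.
have SMcard := @card_eq_mx_of n (fun r => 2 * r) (fun r => [pred f | sm_filling n k p f]) (SMkp n k p).
have Bcard := @card_eq_mx_of n id (fun m => [pred f | upper_filling n k p f]) (Bkp n k p).
apply: card_eq_trans (SMcard _ _ _) _.
- by move=> r r'; lia.
- by move=> r f; exact: SMkp_mx_of.
- move=> X SX; have [[r _ [_ sz dm _ _]] _ _] := SX.
  have [] := @mx_of_surj n (2 * r) X; first by move: dm; rewrite /Defs.dim; lia.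
    by rewrite sz.
  move=> f fX; exists r, f; split=> //.
  (* The [r] left columns are pairwise disjoint, unlike the hooks, so condition (a) forces
     [r <= n]. *)
  move: SX; rewrite -fX => /SMkp_mx_of/and4P[/and3P[_ _ hc] /eqP sf _ _].
  rewrite -sf -[leqLHS]card_ord; apply: card_le_sum_filling hc => i j j' /eqP ij /eqP ij'.
  by apply: val_inj; rewrite -[LHS]ij.
rewrite (@sm_upper_count n n k p) // card_eq_sym; apply: Bcard => //.
- by move=> r f; exact: Bkp_mx_of.
move=> X BX; have [[_ sz _] _ _] := BX.
have [] := @mx_of_surj n (tag X) X => //; first by rewrite sz.
move=> f fX; exists (tag X), f; split=> //.
move: BX; rewrite -[in Bkp _ _ _ X]fX => /Bkp_mx_of/and4P[/and3P[_ hr _] /eqP sf _ _].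
rewrite -sf -[leqLHS]card_ord.
apply: card_le_sum_filling hr => i j j' /eqP ij /eqP ij'.
by apply/val_inj/succn_inj; rewrite -[LHS]ij.
Qed.

Lemma set_bij_of_card_eq T (A B : set T) : A #= B -> exists f : T -> T, set_bij A B f.
Proof.
case: (pselect (inhabited T)) => [[x0]|T0] AB.
  (* The passage from cardinals to a bijection asks for a pointed type, built here from an
     inhabitant; an empty [T] is settled by the identity. *)
  pose U : pointedType := HB.pack T (gen_eqMixin T) (gen_choiceMixin T) (isPointed.Build T x0).
  exact/(@card_set_bijP T U A B).
exists id; split=> [x|x|x]; by case: T0; exists.
Qed.

Theorem theorem2p4 (n : nat) (hn : (1 <= n)%N) :
  exists beta : sqmx -> sqmx,
    set_bij (SM n) (B n) beta /\
    forall k p : nat, set_bij (SMkp n k p) (Bkp n k p) beta.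
Proof.
have /choice[b bP] (kp : nat * nat) := set_bij_of_card_eq (SMkp_eq_Bkp n kp.1 kp.2).
(* The bijections for the pairs [(k, p)] are glued along the fibers of [stat], which partition
   [SM n]. *)
pose stat A := (row_sum A 1, col_sum A (center A)).
pose beta A := b (stat A) A.
have betaE k p A : SMkp n k p A -> beta A = b (k, p) A.
  by case=> _ <- <-.
have beta_kp k p : set_bij (SMkp n k p) (Bkp n k p) beta.
  apply: (eq_set_bijRL _ (bP (k, p))) => A /set_mem SA.
  by rewrite (betaE k p).
exists beta; split=> //; split.
- move=> A SA; have [beta_fun _ _] := beta_kp (stat A).1 (stat A).2.
  by have [] := beta_fun A (And3 SA erefl erefl).
- move=> A A' /set_mem SA /set_mem SA' e.
  have [beta_fun beta_inj _] := beta_kp (stat A).1 (stat A).2.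
  have [beta_fun' _ _] := beta_kp (stat A').1 (stat A').2.
  have [_ p1 k1] := beta_fun A (And3 SA erefl erefl).
  have [_ p2 k2] := beta_fun' A' (And3 SA' erefl erefl).
  (* The statistics can be read off the image, so equal images put [A] and [A'] in the same
     fiber. *)
  apply: beta_inj => //; apply/mem_set; split=> //.
    by rewrite -k1 e k2.
  by rewrite -p1 e p2.
move=> C BC.
have [_ _ beta_surj] := beta_kp (col_sum C (Defs.dim C)) (row_sum C 1).
have [A [SA _ _] AC] := beta_surj C (And3 BC erefl erefl).
by exists A.
Qed.
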